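(* There is a constant $c_1>0$, depending on the problem ($\gamma$, $T$ and the fixed grading exponent $r$) but not on $M,N$, such that if $\epsilon\le c_1M^\gamma$, then the fast implicit difference scheme (FIDS) defined in the context is uniquely solvable and unconditionally stable in the sense that $$\|\boldsymbol u^k\|_\infty\le\|\boldsymbol u^0\|_\infty+\Gamma(1-\gamma)\max_{1\le s\le k}\frac{\|\boldsymbol f^s\|_\infty}{b^{(s,\gamma)}_1},\qquad k=1,2,\dots,M.$$
   Context: Let $0<\gamma<1$, $\alpha\in(0,2)$, $T>0$, $l>0$, and let $\kappa(x,t)>0$, $f(x,t)$, $\phi(x)$ be given functions for $x\in(-l,l)$, $t\in[0,T]$. Let $M,N,r$ be positive integers, $h=2l/N$, $x_i=-l+ih$ ($0\le i\le N$), $t_m=(m/M)^rT$ ($0\le m\le M$), $\tau_m=t_m-t_{m-1}$, $\kappa_i^m=\kappa(x_i,t_m)$, $f_i^m=f(x_i,t_m)$. Temporal coefficients. Put $a^{(m,\gamma)}_k=\frac1{\tau_k}\int_{t_{k-1}}^{t_k}\frac{ds}{(t_m-s)^\gamma}$ for $1\le k\le m$. Let $\epsilon>0$ be a tolerance, $\delta=(1/M)^rT$, and let $N_{exp}\in\mathbb N^+$ and $s_j,w_j>0$ ($1\le j\le N_{exp}$) be such that $\big|t^{-\gamma}-\sum_{j=1}^{N_{exp}}w_je^{-s_jt}\big|\le\epsilon$ for all $t\in[\delta,T]$. Put $$b^{(m,\gamma)}_k=\sum_{j=1}^{N_{exp}}w_j\frac1{\tau_k}\int_{t_{k-1}}^{t_k}e^{-s_j(t_m-s)}ds\quad(1\le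 k\le m-1),\qquad b^{(m,\gamma)}_m=a^{(m,\gamma)}_m .$$ Spatial discretization. Let $\mu\in(\alpha,2]$, $\nu=\mu-\alpha$, $\kappa_\mu=1$ if $\mu\in(\alpha,2)$ and $\kappa_\mu=2$ if $\mu=2$, $c_{1,\alpha}=\frac{2^{\alpha-1}\alpha\Gamma(\frac{\alpha+1}{2})}{\sqrt\pi\,\Gamma(1-\alpha/2)}$, $C^h_{\alpha,\mu}=\frac{c_{1,\alpha}}{\nu h^\alpha}$. For a grid function $v$ with $v_0=v_N=0$ put $(-\Delta)^{\alpha/2}_{h,\mu}v_i=\sum_{j=1}^{N-1}a_{ij}v_j$ ($1\le i\le N-1$), where $$a_{ij}=C^h_{\alpha,\mu}\begin{cases}\sum\limits_{\ell=2}^{N-1}\frac{(\ell+1)^\nu-(\ell-1)^\nu}{\ell^\mu}+\frac{N^\nu-(N-1)^\nu}{N^\mu}+(2^\nu+\kappa_\mu-1)+\frac{2\nu}{\alpha N^\alpha},& j=i,\\[2mm] -\frac{2^\nu+\kappa_\mu-1}{2},& j=i\pm1,\\[1mm] -\frac{(|j-i|+1)^\nu-(|j-i|-1)^\nu}{2|j-i|^\mu},& j\neq i,\,i\pm1.\end{cases}$$ FIDS. The scheme determines $\{u_i^m\}$ by $$\frac1{\Gamma(1-\gamma)}\Big[b^{(m,\gamma)}_mu_i^m-\sum_{k=1}^{m-1}\big(b^{(m,\gamma)}_{k+1}-b^{(m,\gamma)}_k\big)u_i^k-b^{(m,\gamma)}_1u_i^0\Big]=-\kappa_i^m(-\Delta)^{\alpha/2}_{h,\mu}u_i^m+f_i^m$$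 for $1\le i\le N-1$, $1\le m\le M$, with $u_0^m=u_N^m=0$ ($0\le m\le M$) and $u_i^0=\phi(x_i)$ ($1\le i\le N-1$). Write $\boldsymbol u^m=(u_1^m,\dots,u_{N-1}^m)^\top$, $\boldsymbol f^m=(f_1^m,\dots,f_{N-1}^m)^\top$, and $\|\boldsymbol v\|_\infty=\max_{1\le i\le N-1}|v_i|$. *)

(* Defs.v *)
From mathcomp Require Import all_boot all_order all_algebra.
From mathcomp Require Import all_classical all_reals all_analysis.

Set Implicit Arguments.
Unset Strict Implicit.
Unset Printing Implicit Defensive.

Import Order.TTheory GRing.Theory Num.Theory.
Import numFieldNormedType.Exports.

Local Open Scope classical_set_scope.
Local Open Scope ring_scope.

(* Euler's integral; it is only meaningful for z > 0. *)
Definition Gamma (R : realType) (z : R) : R :=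
  \int[@lebesgue_measure R]_(x in `]0, +oo[) (x `^ (z - 1) * expR (- x)).

Definition tgrid (R : realType) (T : R) (r M m : nat) : R :=
  (m%:R / M%:R) ^+ r * T.

Definition tstep (R : realType) (T : R) (r M m : nat) : R :=
  tgrid T r M m - tgrid T r M m.-1.

Definition hstep (R : realType) (l : R) (N : nat) : R := 2 * l / N%:R.

Definition xgrid (R : realType) (l : R) (N i : nat) : R :=
  - l + i%:R * hstep l N.

(* For k = m the integrand takes the junk value 0 at the single point
   s = t_m, which does not affect the Lebesgue integral. *)
Definition acoef (R : realType) (gamma T : R) (r M m k : nat) : R :=
  (tstep T r M k)^-1 *
  \int[@lebesgue_measure R]_(s in `[tgrid T r M k.-1, tgrid T r M k])
    ((tgrid T r M m - s) `^ gamma)^-1.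

Definition soe_approx (R : realType) (gamma eps delta T : R) (Nexp : nat)
    (s w : 'I_Nexp -> R) : Prop :=
  forall t : R, delta <= t <= T ->
    `|t `^ (- gamma) - \sum_(j < Nexp) w j * expR (- s j * t)| <= eps.

(* Meaningful for 1 <= k <= m. *)
Definition bcoef (R : realType) (gamma T : R) (r M Nexp : nat)
    (s w : 'I_Nexp -> R) (m k : nat) : R :=
  if k == m then acoef gamma T r M m m
  else \sum_(j < Nexp) w j * ((tstep T r M k)^-1 *
         \int[@lebesgue_measure R]_(y in `[tgrid T r M k.-1, tgrid T r M k])
           expR (- s j * (tgrid T r M m - y))).

Definition c1alpha (R : realType) (alpha : R) : R :=
  2 `^ (alpha - 1) * alpha * Gamma ((alpha + 1) / 2) /
  (Num.sqrt pi * Gamma (1 - alpha / 2)).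

Definition Calpha (R : realType) (alpha mu l : R) (N : nat) : R :=
  c1alpha alpha / ((mu - alpha) * hstep l N `^ alpha).

Definition kappa_mu (R : realType) (mu : R) : R := if mu == 2 then 2 else 1.

(* Entry a_ij of the matrix of the discrete fractional Laplacian,
   meaningful for 1 <= i, j <= N - 1. *)
Definition fraclap_coef (R : realType) (alpha mu l : R) (N i j : nat) : R :=
  let nu := mu - alpha in
  let d := `|i%:Z - j%:Z|%N in
  Calpha alpha mu l N *
  (if j == i then
     \sum_(2 <= p < N) (p.+1%:R `^ nu - p.-1%:R `^ nu) / p%:R `^ mu
     + (N%:R `^ nu - N.-1%:R `^ nu) / N%:R `^ mu
     + (2 `^ nu + kappa_mu mu - 1)
     + 2 * nu / (alpha * N%:R `^ alpha)
   else if d == 1%N then - ((2 `^ nu + kappa_mu mu - 1) / 2)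
   else - ((d.+1%:R `^ nu - d.-1%:R `^ nu) / (2 * d%:R `^ mu))).

(* Grid functions are indexed by all the nodes 0, ..., N. *)
Definition fraclap (R : realType) (alpha mu l : R) (N : nat)
    (v : 'I_N.+1 -> R) (i : nat) : R :=
  \sum_(j < N.+1 | (0 < j < N)%N) fraclap_coef alpha mu l N i j * v j.

(* The maximum runs over the interior nodes only; the default value 0 is
   harmless since absolute values are nonnegative. *)
Definition supnorm (R : realType) (N : nat) (v : 'I_N.+1 -> R) : R :=
  \big[Num.max/0]_(i < N.+1 | (0 < i < N)%N) `|v i|.

(* Row m, column i of the matrix u is the value u_i^m. *)
Definition FIDS (R : realType) (gamma alpha mu T l : R) (r M N Nexp : nat)
    (s w : 'I_Nexp -> R) (kappa f : R -> R -> R) (phi : R -> R)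
    (u : 'M[R]_(M.+1, N.+1)) : Prop :=
  let b := bcoef gamma T r M s w in
  let x := xgrid l N in
  let t := tgrid T r M in
  [/\ forall (m : 'I_M.+1) (i : 'I_N.+1), (0 < m)%N -> (0 < i < N)%N ->
        (Gamma (1 - gamma))^-1 *
          (b m m * u m i
           - \sum_(k < M.+1 | (0 < k < m)%N) (b m k.+1 - b m k) * u k i
           - b m 1%N * u ord0 i)
        = - kappa (x i) (t m) * fraclap alpha mu l (u m) i + f (x i) (t m),
      forall m : 'I_M.+1, u m ord0 = 0 /\ u m ord_max = 0
    & forall i : 'I_N.+1, (0 < i < N)%N -> u ord0 i = phi (x i)].

(* Main.v *)
Require Import Defs.
From mathcomp Require Import all_boot all_order all_algebra.
From mathcomp Require Import all_classical all_reals all_analysis.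
From mathcomp Require Import measurable_realfun ring lra.

Set Implicit Arguments.
Unset Strict Implicit.
Unset Printing Implicit Defensive.

Import Order.TTheory GRing.Theory Num.Theory.
Import numFieldNormedType.Exports.
Local Open Scope classical_set_scope.
Local Open Scope ring_scope.

(** The scheme is a maximum-principle scheme, and everything follows from two
    structural facts.

    In space, the matrix [a_ij] has a nonnegative diagonal that dominates the
    sum of the absolute values of the off-diagonal entries of its row
    ([fraclap_dominant]): each distance [|i - j|] occurs at most twice in a
    row, each time with half of its weight, and the diagonal entry contains the
    full weights of all the distances up to [N - 1].  Adding a positive
    multiple [beta] of the identity to a nonnegative row scaling of such a
    matrix gives an invertible operator whose inverse is bounded by [1 / beta]
    in the maximum norm ([dominant_max_principle], [dominant_solvable]).

    In time, the weights satisfy [0 < b_1 <= b_2 <= ... <= b_m], so that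
    [b_m u^m] equals, up to the spatial term and the source, a combination of
    [u^0, ..., u^(m-1)] with nonnegative coefficients whose sum telescopes to
    [b_m].  A strong induction on the time level gives the stability bound
    ([memory_stable]); uniqueness is the bound applied to the difference of
    two solutions, and existence solves one dominant system per level.

    The restriction on [eps] serves the monotonicity of the weights.  For
    [k + 1 < m], [b_k] and [b_(k+1)] are averages of an increasing exponential
    sum on consecutive intervals ([expR_average_bounds]).  The last step, from
    [b_(m-1)] to [b_m], passes from
    the exponential sum to the exact kernel: [b_(m-1)] is at most the
    exponential sum at [tau_m], hence at most [tau_m^(-gamma) + eps], whereas
    [b_m = tau_m^(-gamma) / (1 - gamma)].  So
    [eps <= gamma / (1 - gamma) * tau_m^(-gamma)] suffices, and since
    [tau_m <= r T / M], the constant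
    [c_1 = gamma / (1 - gamma) * (r T)^(-gamma)] works ([bcoef_mono]).

    The integrals of the singular kernels [(t_m - s)^(-gamma)] and
    [x^(z - 1)] are computed by a version of the fundamental theorem of
    calculus in which the integrand may be unbounded at both ends of the
    interval ([ge0_FTC2_oo]).  It gives the value of [b_m] and the finiteness,
    hence the positivity, of [Gamma (1 - gamma)]; for an infinite integral the
    real-valued integral would be 0. *)

(** * Diagonally dominant systems *)

(** At an index where [|v|] is maximal, dominance makes the sum over [A] push
    [|beta * v i|] up, never down, whatever the nonnegative row scaling
    [kap]. *)
Lemma dominant_max_principle (R : realFieldType) (n : nat) (P : pred 'I_n)
    (A : 'I_n -> 'I_n -> R) (kap v : 'I_n -> R) (beta c : R) :
  (forall i, P i -> 0 <= kap i) ->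
  (forall i, P i -> \sum_(j | P j && (j != i)) `|A i j| <= A i i) ->
  (forall i, P i -> `|beta * v i + kap i * \sum_(j | P j) A i j * v j| <= c) ->
  forall i, P i -> beta * `|v i| <= c.
Proof.
move=> kap0 domA le_c i0 Pi0.
have [beta_le0|beta_gt0] := leP beta 0.
  apply: le_trans (le_trans (normr_ge0 _) (le_c _ Pi0)).
  by rewrite mulr_le0_ge0.
case: (arg_maxP (fun i => `|v i|) Pi0) => i Pi vmax.
apply: (@le_trans _ _ (beta * `|v i|)); first by rewrite ler_pM2l //; apply: vmax.
apply: le_trans (le_c i Pi).
have offdiag : `|\sum_(j | P j && (j != i)) A i j * v j| <= A i i * `|v i|.
  apply: le_trans (ler_norm_sum _ _ _) _.
  apply: (@le_trans _ _ (\sum_(j | P j && (j != i)) `|A i j| * `|v i|)).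
    apply: ler_sum => j /andP[Pj _].
    by rewrite normrM ler_wpM2l //; apply: vmax.
  by rewrite -mulr_suml ler_wpM2r // domA.
rewrite (bigD1 i) //=.
set S := \sum_(j | _) _ in offdiag *.
have Aii0 : 0 <= A i i by apply: le_trans (domA _ Pi); rewrite sumr_ge0.
rewrite (_ : _ + _ = (beta + kap i * A i i) * v i - (- (kap i * S))); last by ring.
apply: le_trans (lerB_dist _ _).
rewrite normrN !normrM (ger0_norm (kap0 _ Pi)) (ger0_norm (_ : 0 <= beta + _)); last first.
  by rewrite addr_ge0 ?mulr_ge0 ?kap0 // ltW.
rewrite mulrDl -addrA lerDl -mulrA -mulrBr mulr_ge0 ?kap0 //.
by rewrite subr_ge0.
Qed.

(** The maximum principle makes the kernel trivial, so the square system is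
    invertible. *)
Lemma dominant_solvable (R : realFieldType) (n : nat) (P : pred 'I_n)
    (A : 'I_n -> 'I_n -> R) (kap h : 'I_n -> R) (beta : R) :
  0 < beta ->
  (forall i, P i -> 0 <= kap i) ->
  (forall i, P i -> \sum_(j | P j && (j != i)) `|A i j| <= A i i) ->
  exists v : 'rV[R]_n,
    (forall i, P i ->
       beta * v 0 i + kap i * \sum_(j | P j) A i j * v 0 j = h i) /\
    (forall i, ~~ P i -> v 0 i = 0).
Proof.
move=> beta0 kap0 domA.
(* Outside [P] the matrix is the identity: this encodes the boundary
   conditions, so that a single square system on ['I_n] is solved. *)
pose B : 'M[R]_n := \matrix_(j, i)
  (if P i then beta * (j == i)%:R + kap i * (if P j then A i j else 0)
   else (j == i)%:R).
have BE (v : 'rV_n) i : (v *m B) 0 i =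
    if P i then beta * v 0 i + kap i * \sum_(j | P j) A i j * v 0 j else v 0 i.
  rewrite mxE; case Pi: (P i); last first.
    rewrite (bigD1 i) //= big1 ?addr0 ?mxE ?Pi ?eqxx ?mulr1 // => j /negPf ji.
    by rewrite mxE Pi ji mulr0.
  under eq_bigr => j _ do rewrite mxE Pi mulrDr.
  rewrite big_split /=; congr (_ + _).
    rewrite (bigD1 i) //= big1 ?addr0 ?eqxx ?mulr1 1?mulrC // => j /negPf ji.
    by rewrite ji !mulr0.
  rewrite mulr_sumr [RHS]big_mkcond /=; apply: eq_bigr => j _.
  by case: (P j); [ring | rewrite !mulr0].
have Bunit : B \in unitmx.
  rewrite -row_free_unit -kermx_eq0; apply/rowV0P => v /sub_kermxP vB0.
  apply/rowP => i; rewrite [RHS]mxE.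
  have vB0i j : (v *m B) 0 j = 0 by rewrite vB0 mxE.
  have [Pi|nPi] := boolP (P i); last by have := vB0i i; rewrite BE (negPf nPi).
  have : beta * `|v 0 i| <= 0.
    apply: (@dominant_max_principle _ _ P A kap (v 0)) => // j Pj.
    by have := vB0i j; rewrite BE Pj => ->; rewrite normr0.
  by rewrite pmulr_rle0 // normr_le0 => /eqP.
exists ((\row_i if P i then h i else 0) *m invmx B).
set v := _ *m _.
have vE i : (v *m B) 0 i = if P i then h i else 0 by rewrite mulmxKV // mxE.
split=> i Pi; first by have := vE i; rewrite BE Pi.
by have := vE i; rewrite BE (negPf Pi).
Qed.

(** * Implicit schemes with memory *)

Section MemoryScheme.
Variables (R : realFieldType) (M n : nat) (P : pred 'I_n).
Variables (A : 'I_n -> 'I_n -> R) (kap : nat -> 'I_n -> R) (b : nat -> nat -> R).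
Variable G : R.
Hypotheses (G_gt0 : 0 < G)
  (kap_ge0 : forall m i, (0 < m <= M)%N -> P i -> 0 <= kap m i)
  (domA : forall i, P i -> \sum_(j | P j && (j != i)) `|A i j| <= A i i)
  (b1_gt0 : forall m, (0 < m <= M)%N -> 0 < b m 1%N)
  (b_mono : forall m k, (0 < k < m)%N -> (m <= M)%N -> b m k <= b m k.+1).

(** Level [m] of the scheme, for an arbitrary spatial matrix [A] with row
    scaling [kap], arbitrary temporal weights [b], and [G] in the place of
    [Gamma (1 - gamma)]; the nodes in [P] carry the equations, and the other
    nodes the zero boundary values. *)
Definition memory_step (f : nat -> 'I_n -> R) (u : 'M[R]_(M.+1, n)) (m : 'I_M.+1) :=
  forall i, P i ->
    G^-1 * (b m m * u m i
       - \sum_(k < M.+1 | (0 < k < m)%N) (b m k.+1 - b m k) * u k i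
       - b m 1%N * u ord0 i)
    = - kap m i * (\sum_(j | P j) A i j * u m j) + f m i.

Definition maxnorm (v : 'I_n -> R) : R := \big[Num.max/0]_(i | P i) `|v i|.

Lemma maxnorm_ge0 v : 0 <= maxnorm v.
Proof. exact: bigmax_ge_id. Qed.

Lemma le_maxnorm v i : P i -> `|v i| <= maxnorm v.
Proof. by move=> Pi; apply: (@le_bigmax_cond _ _ _ 0 i P (fun i => `|v i|)). Qed.

(** The increments of the weights and [b m 1], the coefficients of the past
    levels, are nonnegative and have sum [b m m]: after division by [b m m] the
    past enters through a convex combination. *)
Lemma weights_telescope m : (0 < m <= M)%N ->
  \sum_(k < M.+1 | (0 < k < m)%N) (b m k.+1 - b m k) + b m 1%N = b m m.
Proof.
move=> /andP[m0 mM].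
rewrite -(big_mkord (fun k => (0 < k < m)%N) (fun k => b m k.+1 - b m k)).
rewrite (_ : \sum_(0 <= k < M.+1 | _) _ = \sum_(1 <= k < m) (b m k.+1 - b m k)).
  by rewrite telescope_sumr // subrK.
rewrite [RHS](big_nat_widen _ _ M.+1) ?(leq_trans mM) // [RHS](big_nat_widenl _ 0%N) //.
by apply: eq_bigl => k; rewrite andbC.
Qed.

Lemma last_weight_gt0 m : (0 < m <= M)%N -> 0 < b m m.
Proof.
move=> /[dup] /andP[m0 mM] mP; rewrite -weights_telescope //.
by rewrite ltr_wpDl ?b1_gt0 // sumr_ge0 // => k km; rewrite subr_ge0 b_mono.
Qed.

Definition data_bound (f : nat -> 'I_n -> R) (u0 : 'I_n -> R) (k : nat) : R :=
  maxnorm u0 + G * \big[Num.max/0]_(1 <= p < k.+1) (maxnorm (f p) / b p 1%N).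

(** Strong induction on the level: if the past levels are bounded by [E], the
    maximum principle gives [b_k |u^k| <= (b_k - b_1) E + b_1 |u^0| + G |f^k|],
    and [b_1 |u^0| + G |f^k| <= b_1 E] because the quotient
    [|f^k| / b_1] is one of the terms of the maximum in [E]. *)
Lemma memory_stable f (u : 'M[R]_(M.+1, n)) :
  (forall m : 'I_M.+1, (0 < m)%N -> memory_step f u m) ->
  forall k : 'I_M.+1, maxnorm (u k) <= data_bound f (u ord0) k.
Proof.
move=> stepu k.
have [m] := ubnP (k : nat); elim: m k => // m IH k; rewrite ltnS => km.
have E_ge0 q : 0 <= \big[Num.max/0]_(1 <= p < q) (maxnorm (f p) / b p 1%N).
  exact: bigmax_ge_id.
have [k0|k_gt0] := posnP k.
  rewrite (_ : k = ord0); last exact: val_inj.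
  by rewrite lerDl mulr_ge0 // ltW.
have kM : (k <= M)%N by rewrite -ltnS.
have kP : (0 < k <= M)%N by rewrite k_gt0.
have bk := last_weight_gt0 kP; have bk1 := b1_gt0 kP.
set E := data_bound f (u ord0) k.
have IHE (q : 'I_M.+1) : (q < k)%N -> maxnorm (u q) <= E.
  move=> qk; apply: le_trans (IH _ (leq_trans qk km)) _.
  by rewrite lerD2l ler_pM2l //; apply: le_bigmax_nat => //; exact: ltnW.
have dataE : b k 1%N * maxnorm (u ord0) + G * maxnorm (f k) <= b k 1%N * E.
  rewrite mulrDr lerD2l mulrCA ler_pM2l // -ler_pdivrMl // mulrC.
  apply: (@bigmax_sup_seq _ _ _ _ 0 (k : nat)) => //.
  by rewrite mem_index_iota k_gt0 /=.
have bound i : P i -> (G^-1 * b k k) * `|u k i| <= G^-1 * b k k * E.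
  apply: (@dominant_max_principle _ _ P A (kap k) (u k)) => // {}i Pi.
    exact: kap_ge0.
  have -> : G^-1 * b k k * u k i + kap k i * \sum_(j | P j) A i j * u k j
      = G^-1 * (\sum_(q < M.+1 | (0 < q < k)%N) (b k q.+1 - b k q) * u q i
                + b k 1%N * u ord0 i + G * f k i).
    rewrite mulrDr mulKf ?gt_eqF //; have := stepu k k_gt0 i Pi.
    set S := \sum_(j | _) _; set H := \sum_(j < _ | _) _; move=> e.
    by lra.
  rewrite normrM gtr0_norm ?invr_gt0 // -mulrA ler_pM2l ?invr_gt0 //.
  apply: le_trans (ler_normD _ _) _.
  apply: (@le_trans _ _ (\sum_(q < M.+1 | (0 < q < k)%N) (b k q.+1 - b k q) * E
                         + b k 1%N * E)); last first.
    by rewrite -mulr_suml -mulrDl weights_telescope.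
  apply: le_trans (lerD (ler_normD _ _) (lexx _)) _.
  rewrite -addrA lerD //; last first.
    apply: le_trans dataE; rewrite !normrM (gtr0_norm bk1) (gtr0_norm G_gt0) lerD //.
      by rewrite ler_pM2l // le_maxnorm.
    by rewrite ler_pM2l // le_maxnorm.
  apply: le_trans (ler_norm_sum _ _ _) _; apply: ler_sum => q qk.
  have bq : 0 <= b k q.+1 - b k q by rewrite subr_ge0 b_mono.
  rewrite normrM ger0_norm // ler_wpM2l //.
  apply: le_trans (le_maxnorm (u q) Pi) (IHE q _); by case/andP: qk.
apply/bigmax_leP; split=> [|i Pi]; first by rewrite addr_ge0 ?maxnorm_ge0 ?mulr_ge0 // ltW.
by have := bound i Pi; rewrite ler_pM2l // mulr_gt0 ?invr_gt0.
Qed.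

Definition memory_scheme f (u0 : 'I_n -> R) (u : 'M[R]_(M.+1, n)) :=
  [/\ forall m : 'I_M.+1, (0 < m)%N -> memory_step f u m,
      forall m i, ~~ P i -> u m i = 0
    & forall i, P i -> u ord0 i = u0 i].

(** The difference of two solutions has zero data, hence a zero stability
    bound. *)
Lemma memory_scheme_uniq f u0 u u' :
  memory_scheme f u0 u -> memory_scheme f u0 u' -> u = u'.
Proof.
move=> [stepu bdu iniu] [stepu' bdu' iniu'].
have norm00 : maxnorm (fun=> 0) = 0.
  apply/eqP; rewrite eq_le maxnorm_ge0 andbT.
  by apply: bigmax_le => // i _; rewrite normr0.
have stepB (m : 'I_M.+1) : (0 < m)%N -> memory_step (fun _ _ => 0) (u - u') m.
  move=> m0 i Pi; have e := stepu m m0 i Pi; have e' := stepu' m m0 i Pi.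
  rewrite !mxE.
  have entryB (k : 'I_M.+1) j : (u - u') k j = u k j - u' k j by rewrite !mxE.
  rewrite (eq_bigr (fun k : 'I_M.+1 => (b m k.+1 - b m k) * u k i
                            - (b m k.+1 - b m k) * u' k i)); last first.
    by move=> k _; rewrite entryB mulrBr.
  rewrite [in RHS](eq_bigr (fun j => A i j * u m j - A i j * u' m j)); last first.
    by move=> j _; rewrite entryB mulrBr.
  rewrite !sumrB.
  by lra.
apply/matrixP => m i.
have [Pi|nPi] := boolP (P i); last by rewrite bdu // bdu'.
have := memory_stable stepB m.
have -> : data_bound (fun _ _ => 0) ((u - u') ord0) m = 0.
  rewrite /data_bound bigmax_eq_id ?mulr0 ?addr0; last first.
    by move=> p _; rewrite norm00 mul0r.
  apply/eqP; rewrite eq_le maxnorm_ge0 andbT; apply/bigmax_leP; split=> // j Pj.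
  by rewrite !mxE iniu // iniu' // subrr normr0.
move=> /(le_trans (le_maxnorm ((u - u') m) Pi)); rewrite normr_le0 !mxE subr_eq0.
by move/eqP.
Qed.

(** Levels are filled in one at a time; the equations of the earlier levels
    are unaffected since they involve no later level. *)
Lemma memory_scheme_exists f u0 : exists u, memory_scheme f u0 u.
Proof.
suff ex q : exists u : 'M[R]_(M.+1, n),
   [/\ forall m : 'I_M.+1, (0 < m <= q)%N -> memory_step f u m,
      forall m i, ~~ P i -> u m i = 0
    & forall i, P i -> u ord0 i = u0 i].
  have [u [stepu bdu iniu]] := ex M; exists u; split=> // m m0.
  by apply: stepu; rewrite m0 -ltnS ltn_ord.
elim: q => [|q [u [stepu bdu iniu]]].
  exists (\matrix_(m, i) if P i then u0 i else 0); split=> [m|m i|i].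
  - by case: (m : nat).
  - by rewrite mxE => /negPf ->.
  - by rewrite mxE => ->.
have [qM|Mq] := ltnP q.+1 M.+1; last first.
  exists u; split=> // m /andP[m0 mq]; apply: stepu.
  by rewrite m0 -ltnS (leq_trans (ltn_ord m)).
pose m1 : 'I_M.+1 := Ordinal qM.
have m1P : (0 < m1 <= M)%N by [].
have c0 : 0 < G^-1 * b m1 m1 by rewrite mulr_gt0 ?invr_gt0 ?last_weight_gt0.
have [v [vstep vbd]] := @dominant_solvable _ _ P A (kap m1)
  (fun i => G^-1 * (\sum_(k < M.+1 | (0 < k < m1)%N) (b m1 k.+1 - b m1 k) * u k i
                    + b m1 1%N * u ord0 i) + f m1 i) (G^-1 * b m1 m1)
  c0 (fun i => kap_ge0 m1P) domA.
pose u1 : 'M[R]_(M.+1, n) := \matrix_(m, i) if m == m1 then v 0 i else u m i.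
have u1E m : m != m1 -> u1 m =1 u m by move=> /negPf e i; rewrite mxE e.
have u1m1 i : u1 m1 i = v 0 i by rewrite mxE eqxx.
have ord0_neq : ord0 != m1 by [].
exists u1; split=> [m /andP[m0 mq]|m i nPi|i Pi]; last 2 first.
- by rewrite mxE; case: eqP => _; [exact: vbd | exact: bdu].
- by rewrite u1E // iniu.
have hist i : \sum_(k < M.+1 | (0 < k < m)%N) (b m k.+1 - b m k) * u1 k i
            = \sum_(k < M.+1 | (0 < k < m)%N) (b m k.+1 - b m k) * u k i.
  apply: eq_bigr => k /andP[_ km]; rewrite u1E //.
  by rewrite -val_eqE /= ltn_eqF // (leq_trans km).
move=> i Pi; rewrite hist (u1E ord0) //.
have [mm1|mm1] := eqVneq m m1.
  rewrite mm1 u1m1 [in RHS](eq_bigr (fun j => A i j * v 0 j)); last first.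
    by move=> j _; rewrite u1m1.
  have := vstep i Pi.
  set S := \sum_(j | _) _; set H := \sum_(j < _ | _) _; move=> e.
  by lra.
rewrite u1E // [in RHS](eq_bigr (fun j => A i j * u m j)); last first.
  by move=> j _; rewrite u1E.
apply: stepu => //; rewrite m0 /= -ltnS ltn_neqAle mq andbT.
by rewrite -val_eqE in mm1.
Qed.

End MemoryScheme.

(** * Discrete fractional Laplacian *)

Lemma ler_sum_nat_widen (R : numDomainType) (g : nat -> R) (a m n : nat) :
  (forall p, 0 <= g p) -> (m <= n)%N ->
  \sum_(a <= p < m) g p <= \sum_(a <= p < n) g p.
Proof.
move=> g0 mn; rewrite (big_nat_widen _ _ n) // big_mkcond /=.
by apply: ler_sum => p _; case: ifP.
Qed.

(** The distances from [i] to the nodes on its left are distinct, and so are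
    those to the nodes on its right. *)
Lemma sum_distance_le (R : numDomainType) (g : nat -> R) (N i : nat) :
  (forall p, 0 <= g p) -> (0 < i < N)%N ->
  \sum_(j < N.+1 | (0 < j < N)%N && (j != i :> nat)) g `|i%:Z - j%:Z|%N
    <= (\sum_(1 <= p < N) g p) *+ 2.
Proof.
move=> g0 /andP[i0 iN].
rewrite -(big_mkord (fun j => (0 < j < N)%N && (j != i)) (fun j => g `|i%:Z - j%:Z|%N)).
rewrite (_ : \sum_(0 <= j < N.+1 | _) _ =
             \sum_(1 <= j < N | j != i) g `|i%:Z - j%:Z|%N); last first.
  rewrite [RHS](big_nat_widen _ _ N.+1) // [RHS](big_nat_widenl _ 0%N) //.
  by apply: eq_bigl => j; rewrite andbC andbA [LHS]andbC andbA; case: (j != i); rewrite ?andbF ?andbT.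
rewrite (@big_cat_nat _ _ _ i) //= 1?ltnW //.
rewrite mulr2n lerD //.
  apply: le_trans (ler_sum_nat_widen 1 g0 (ltnW iN)).
  rewrite [leRHS]big_nat_rev /= big_nat_cond [leRHS]big_nat_cond.
  rewrite big_mkcond [leRHS]big_mkcond /=; apply: ler_sum => j _.
  case: ifP => [/andP[/andP[j0 ji] _]|_]; last by case: ifP.
  by rewrite j0 ji /= add1n subSS distnEl // ltnW.
rewrite big_ltn_cond // eqxx /= -{1}[i.+1]add1n big_addn.
apply: le_trans (ler_sum_nat_widen 1 g0 (leq_subr _ _)).
rewrite big_mkcond; apply: ler_sum => j _; case: ifP => // _.
by rewrite distnEr ?leq_addl // addnK.
Qed.

Section FractionalLaplacian.
Variables (R : realType) (alpha mu l : R) (N : nat).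
Hypotheses (halpha : 0 < alpha) (hmu : alpha < mu).
Let nu := mu - alpha.

Let nu_ge0 : 0 <= nu.
Proof. by rewrite subr_ge0 ltW. Qed.

Lemma powR_gap_ge0 (p : nat) : 0 <= p.+1%:R `^ nu - p.-1%:R `^ nu :> R.
Proof.
rewrite subr_ge0 ge0_ler_powR ?nnegrE ?nu_ge0 //.
by rewrite ler_nat (leq_trans (leq_pred _)).
Qed.

(** Its Gamma values are integrals of nonnegative functions; a nonnegative
    factor preserves dominance. *)
Lemma Calpha_ge0 : 0 <= Calpha alpha mu l N.
Proof.
have Gamma_ge0 (z : R) : 0 <= Gamma z.
  by apply: Rintegral_ge0 => x _; rewrite mulr_ge0 ?powR_ge0 ?expR_ge0.
rewrite /Calpha /c1alpha !divr_ge0 ?mulr_ge0 ?powR_ge0 ?Gamma_ge0 ?sqrtr_ge0 //.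
  exact: ltW.
Qed.

(** The off-diagonal entries are [- Calpha / 2] times these weights, and the
    diagonal entry is [Calpha] times their sum plus nonnegative terms. *)
Definition offdiag_weight (p : nat) : R :=
  if p == 1%N then 2 `^ nu + kappa_mu mu - 1
  else (p.+1%:R `^ nu - p.-1%:R `^ nu) / p%:R `^ mu.

Lemma offdiag_weight_ge0 p : 0 <= offdiag_weight p.
Proof.
rewrite /offdiag_weight; case: ifP => _; last by rewrite divr_ge0 ?powR_ge0 ?powR_gap_ge0.
rewrite -addrA addr_ge0 ?powR_ge0 // /kappa_mu.
by case: ifP => _; lra.
Qed.

Lemma fraclap_coef_offdiag (i j : nat) : j != i ->
  fraclap_coef alpha mu l N i j =
  - (Calpha alpha mu l N * (offdiag_weight `|i%:Z - j%:Z|%N / 2)).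
Proof.
move=> /negPf ji; rewrite /fraclap_coef ji /offdiag_weight.
case: ifP => _; first by rewrite mulrN.
by rewrite mulrN invfM [2^-1 * _]mulrC !mulrA.
Qed.

(** The sum over the row runs twice through distances below [N], with half
    weights; the diagonal entry has a full copy of each weight. *)
Lemma fraclap_dominant i : (0 < i < N)%N ->
  \sum_(j < N.+1 | (0 < j < N)%N && (j != i :> nat)) `|fraclap_coef alpha mu l N i j|
    <= fraclap_coef alpha mu l N i i.
Proof.
move=> iN.
have C0 := Calpha_ge0.
under eq_bigr => j /andP[_ ji].
  rewrite fraclap_coef_offdiag // normrN ger0_norm; last first.
    by rewrite mulr_ge0 // divr_ge0 // offdiag_weight_ge0.
  over.
rewrite -mulr_sumr -mulr_suml /fraclap_coef eqxx ler_wpM2l //.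
rewrite ler_pdivrMr // mulr_natr.
apply: le_trans (sum_distance_le offdiag_weight_ge0 iN) _.
rewrite lerMn2r /=.
have N1 : (1 < N)%N by case/andP: iN => /leq_ltn_trans; apply.
rewrite big_ltn // {1}/offdiag_weight eqxx.
rewrite (_ : \sum_(2 <= p < N) offdiag_weight p =
  \sum_(2 <= p < N) (p.+1%:R `^ nu - p.-1%:R `^ nu) / p%:R `^ mu); last first.
  by apply: eq_big_nat => p /andP[p2 _]; rewrite /offdiag_weight gtn_eqF.
rewrite -/nu.
have h1 : 0 <= (N%:R `^ nu - N.-1%:R `^ nu) / N%:R `^ mu :> R.
  rewrite divr_ge0 ?powR_ge0 // subr_ge0 ge0_ler_powR ?nnegrE ?nu_ge0 //.
  by rewrite ler_nat leq_pred.
have h2 : 0 <= 2 * nu / (alpha * N%:R `^ alpha).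
  by rewrite divr_ge0 ?mulr_ge0 ?powR_ge0 ?subr_ge0 // ltW.
lra.
Qed.

End FractionalLaplacian.

(** * Integrals with endpoint singularities *)

Section ImproperFTC.
Context {R : realType}.
Notation mu := (@lebesgue_measure R).

Lemma itv_oo_bigcup (a b : R) : (a < b)%R ->
  `]a, b[%classic =
  \bigcup_n `[a + (b - a) / n.+3%:R, b - (b - a) / n.+3%:R]%classic.
Proof.
move=> ab; have ba0 : 0 < b - a by rewrite subr_gt0.
apply/seteqP; split=> x /=; last first.
  move=> [n _] /=; rewrite !in_itv /= => /andP[ax xb].
  have : 0 < (b - a) / n.+3%:R by rewrite divr_gt0.
  move: (_ / _) ax xb => d ax xb d0.
  by apply/andP; split; lra.
rewrite in_itv /= => /andP[ax xb].
pose e := Num.min (x - a) (b - x).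
have e0 : 0 < e by rewrite lt_min !subr_gt0 ax xb.
(* Any index [n] with [(b - a) / e < n + 3] works. *)
exists (Num.truncn ((b - a) / e)) => //=.
have : (b - a) / (Num.truncn ((b - a) / e)).+3%:R <= e.
  rewrite ler_pdivrMr // mulrC -ler_pdivrMr // ltW //.
  apply: (lt_le_trans (truncnS_gt _)).
  by rewrite ler_nat -[leqRHS]addn2 leq_addr.
rewrite le_min in_itv /= => /andP[].
move: (_ / _) => d h1 h2.
by apply/andP; split; lra.
Qed.

(** The integrand may blow up at both ends.  The usual theorem applies on the
    closed intervals [[a + d_n, b - d_n]] exhausting the open one, and monotone
    convergence passes to the limit. *)
Lemma ge0_FTC2_oo (f F : R -> R) (a b : R) : a < b ->
  {in `]a, b[, continuous f} ->
  {in `]a, b[, forall x, 0 <= f x} ->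
  derivable_oo_LRcontinuous F a b ->
  {in `]a, b[, F^`()%classic =1 f} ->
  (\int[mu]_(x in `]a, b[) (f x)%:E = (F b - F a)%:E)%E.
Proof.
move=> ab cf f0 [dF Fa Fb] F'f.
have ba0 : 0 < b - a by rewrite subr_gt0.
(* The denominator [n + 3] keeps the intervals nondegenerate for every [n]. *)
pose d n : R := (b - a) / n.+3%:R.
have d0 n : 0 < d n by rewrite divr_gt0.
have d3 n : 3 * d n <= b - a.
  by rewrite /d mulrA ler_pdivrMr // mulrC ler_pM2l // ler_nat.
have sub n x : x \in `[a + d n, b - d n] -> x \in `]a, b[.
  rewrite !in_itv /= => /andP[ax xb]; have := d0 n.
  by move=> ?; apply/andP; split; lra.
have subo n x : x \in `]a + d n, b - d n[ -> x \in `]a, b[.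
  by rewrite in_itv /= => /andP[ax xb]; apply: (sub n); rewrite in_itv /= !ltW.
have cvgd : d n @[n --> \oo] --> (0 : R).
  rewrite -(mulr0 (b - a)); apply: cvgMr.
  have := @cvg_harmonic R; rewrite -(cvg_shiftn 2) /=.
  by apply: cvg_trans; apply: near_eq_cvg; near=> n; rewrite /harmonic addn2.
rewrite itv_oo_bigcup //.
set D := fun n => `[a + (b - a) / n.+3%:R, b - (b - a) / n.+3%:R]%classic.
have cvgI : (\int[mu]_(x in D n) (f x)%:E)%E @[n --> \oo] -->
            (\int[mu]_(x in \bigcup_n D n) (f x)%:E)%E.
  apply: ge0_nondecreasing_set_cvg_integral => //=.
  - apply/nondecreasing_seqP => n; rewrite subsetEset.
    apply: subset_itv; rewrite bnd_simp.
      by rewrite lerD2l ler_pM2l // lef_pV2 ?posrE // ler_nat.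
    by rewrite lerD2l lerN2 ler_pM2l // lef_pV2 ?posrE // ler_nat.
  - by move=> n; exact: measurable_itv.
  - move=> n; apply: (measurable_EFinP _ f).2.
    apply: subspace_continuous_measurable_fun; first exact: measurable_itv.
    apply: continuous_in_subspaceT => x; rewrite inE /= => /sub; exact: cf.
  - by move=> n x /= /sub /f0; rewrite lee_fin.
apply: (cvg_unique _ cvgI) => //.
have intE n : (\int[mu]_(x in `[(a + d n)%R, (b - d n)%R]) (f x)%:E =
               (F (b - d n) - F (a + d n))%:E)%E.
  have lt : a + d n < b - d n by have := d3 n; have := d0 n; lra.
  rewrite EFinB; apply: continuous_FTC2 => //.
  - apply: continuous_in_subspaceT => x; rewrite inE /= => /sub; exact: cf.
  - have cF x : x \in `[a + d n, b - d n] -> {for x, continuous F}.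
      move=> /sub /dF dFx; apply/differentiable_continuous.
      exact/derivable1_diffP.
    split.
    + by move=> x xab; exact/dF/(subo n).
    + by apply: cvg_at_right_filter; apply: cF; rewrite in_itv /= lexx ltW.
    + by apply: cvg_at_left_filter; apply: cF; rewrite in_itv /= lexx ltW.
  - by move=> x xab; exact/F'f/(subo n).
rewrite (_ : (fun _ => _) = (fun n => (F (b - d n) - F (a + d n))%:E)); last first.
  by apply/funext => n; rewrite intE.
apply: cvg_EFin; first exact: nearW.
apply: cvgB.
- move/cvg_at_leftP : Fb; apply; split=> [n|]; first by rewrite ltrBlDr ltrDl.
  by rewrite -[X in _ --> X]subr0; apply: cvgB => //; exact: cvg_cst.
- move/cvg_at_rightP : Fa; apply; split=> [n|]; first by rewrite ltrDl.
  by rewrite -[X in _ --> X]addr0; apply: cvgD => //; exact: cvg_cst.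
Unshelve. all: by end_near. Qed.

End ImproperFTC.

Section PowerIntegrals.
Context {R : realType}.
Notation mu := (@lebesgue_measure R).

Lemma continuous_powR_gt0 (p x : R) : 0 < x -> {for x, continuous (fun y : R => y `^ p)}.
Proof.
move=> x0; apply/differentiable_continuous/derivable1_diffP.
by apply: derivable_powR; rewrite in_itv /= x0.
Qed.

Lemma continuous_powR_reflect (p c x : R) : x < c ->
  {for x, continuous (fun y : R => (c - y) `^ p)}.
Proof.
move=> xc.
apply: (@continuous_comp _ _ _ (fun y : R => c - y) (fun y : R => y `^ p)).
  by apply: cvgB; [exact: cvg_cst | exact: cvg_id].
by apply: continuous_powR_gt0; rewrite subr_gt0.
Qed.

Lemma integral_powR_oo (p c : R) : -1 < p -> 0 < c ->
  (\int[mu]_(x in `]0%R, c[) (x `^ p)%:E = (c `^ (p + 1) / (p + 1))%:E)%E.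
Proof.
move=> p1 c0; have q0 : 0 < p + 1 by lra.
rewrite (@ge0_FTC2_oo _ _ (fun x : R => (p + 1)^-1 * x `^ (p + 1))) //.
- by rewrite powR0 ?gt_eqF // mulr0 subr0 mulrC.
- by move=> x; rewrite in_itv /= => /andP[x0 _]; exact: continuous_powR_gt0.
- by move=> x _; exact: powR_ge0.
- split.
  + move=> x; rewrite in_itv /= => /andP[x0 _].
    by apply: derivableM => //; apply: derivable_powR; rewrite in_itv /= x0.
  + by rewrite powR0 ?gt_eqF //; apply: cvgMr; exact: powR_cvg0.
  + by apply: cvg_at_left_filter; apply: cvgMr; exact: continuous_powR_gt0.
- move=> x; rewrite in_itv /= => /andP[x0 _].
  have dx : derivable (fun y : R => y `^ (p + 1)) x 1.
    by apply: derivable_powR; rewrite in_itv /= x0.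
  rewrite derive1E deriveZ //= -derive1E powR_derive1 ?in_itv /= ?x0 //.
  by rewrite addrK /GRing.scale /= mulrA mulVf ?mul1r // gt_eqF.
Qed.

Lemma Rintegral_powRV_reflect (gamma a c : R) : 0 < gamma < 1 -> a < c ->
  \int[mu]_(s in `[a, c]) ((c - s) `^ gamma)^-1 =
  (c - a) `^ (1 - gamma) / (1 - gamma).
Proof.
move=> /andP[g0 g1] ac; have q0 : 0 < 1 - gamma by lra.
have dc (s : R) : s < c -> is_derive s 1 (fun s => (c - s) `^ (1 - gamma))
   (- ((1 - gamma) * (c - s) `^ (1 - gamma - 1))).
  move=> sc; have cs : 0 < c - s by lra.
  have := @is_derive1_powR R (1 - gamma) _ cs => d1.
  have d2 : is_derive s 1 (fun s : R => c - s) (-1).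
    by apply: is_derive_eq; rewrite add0r mul1r.
  have := @is_derive1_comp _ (fun y : R => y `^ (1 - gamma)) (fun y => c - y) _ _ _ d1 d2.
  by rewrite mulrN1.
under eq_Rintegral => s _ do rewrite -powRN.
rewrite /Rintegral integral_itv_bndoo; last first.
  apply/measurable_EFinP.
  apply: (@measurableT_comp _ _ _ _ _ _ (fun y : R => y `^ (- gamma))).
    exact: measurable_powR.
  by apply: measurable_funB.
rewrite (@ge0_FTC2_oo _ _ (fun s : R => - (1 - gamma)^-1 * (c - s) `^ (1 - gamma))) //.
- by rewrite subrr powR0 ?gt_eqF //= mulr0 sub0r mulNr opprK mulrC.
- move=> s; rewrite in_itv /= => /andP[_ sc].
  exact: continuous_powR_reflect.
- by move=> s _; exact: powR_ge0.
- split.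
  + move=> s; rewrite in_itv /= => /andP[_ sc].
    have [d1 _] := dc _ sc; apply: derivableM; [exact: derivable_cst|exact: d1].
  + apply: cvg_at_right_filter; apply: cvgMr.
    exact: continuous_powR_reflect.
  + apply: cvgMr; rewrite subrr powR0 ?gt_eqF //.
    apply/cvg_at_leftP => u [uc ucvg].
    have /cvg_at_rightP := powR_cvg0 q0.
    apply; split=> [n|]; first by rewrite subr_gt0.
    by rewrite -[X in _ --> X](subrr c); apply: cvgB => //; exact: cvg_cst.
- move=> s; rewrite in_itv /= => /andP[_ sc].
  have [d1 d2] := dc _ sc.
  rewrite derive1E deriveZ //= d2 /GRing.scale /= mulrNN mulrA mulVf ?mul1r ?gt_eqF //.
  by congr (_ `^ _); lra.
Qed.

End PowerIntegrals.

(** * Positivity of the Gamma function *)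

Section GammaPos.
Context {R : realType}.
Notation mu := (@lebesgue_measure R).

(** The integral is at least that of a positive constant on [[1, 2]].  It is
    finite since the integrand is at most [x^(z-1)] on ]0, 1[ and, because
    [z <= 1], at most [e^(-x)] on [1, +oo[. *)
Lemma Gamma_gt0 (z : R) : 0 < z <= 1 -> 0 < Gamma z.
Proof.
move=> /andP[z0 z1].
pose f (x : R) := x `^ (z - 1) * expR (- x).
have f0 x : 0 <= f x by rewrite mulr_ge0 ?powR_ge0 ?expR_ge0.
have mf D : measurable_fun D (fun x => (f x)%:E).
  apply: measurable_funTS; apply/measurable_EFinP; apply: measurable_funM.
    exact: measurable_powR.
  by apply: measurableT_comp => //; exact: measurable_expR.
rewrite /Gamma /Rintegral fine_gt0 //; apply/andP; split.
  pose c : R := 2 `^ (z - 1) * expR (- 2).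
  have c0 : 0 < c by rewrite mulr_gt0 ?powR_gt0 ?expR_gt0.
  apply: (@lt_le_trans _ _ (\int[mu]_(x in `[1%R, 2%R]) c%:E)%E).
    rewrite integral_cst //= lebesgue_measure_itv /= lte_fin ltr1n /=.
    by rewrite -EFinB -EFinM lte_fin mulr_gt0 // subr_gt0 ltr1n.
  apply: (@le_trans _ _ (\int[mu]_(x in `[1%R, 2%R]) (f x)%:E)%E).
    apply: ge0_le_integral => //=.
    - by move=> x _; rewrite lee_fin ltW.
    - exact: mf.
    - move=> x; rewrite in_itv /= => /andP[x1 x2]; rewrite lee_fin.
      rewrite ler_pM ?powR_ge0 ?expR_ge0 ?ler_expR ?lerN2 //.
      rewrite -[z - 1]opprB !powRN lef_pV2 ?posrE ?powR_gt0 //; last by lra.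
      by rewrite ge0_ler_powR ?nnegrE //; lra.
  apply: ge0_subset_integral => //=.
  - exact: mf.
  - by move=> x _; rewrite lee_fin f0.
  - by move=> x /=; rewrite !in_itv /= => /andP[x1 _]; rewrite andbT; lra.
rewrite (@itv_bndbnd_setU _ _ _ (BLeft 1%R)) ?bnd_simp //.
rewrite ge0_integral_setU //=; last 3 first.
- exact: mf.
- by move=> x _; rewrite lee_fin f0.
- rewrite disj_set2E; apply/eqP/seteqP; split=> x //= [].
  by rewrite !in_itv /= => /andP[_ x1] /andP[]; lra.
apply: lte_add_pinfty.
  apply: (@le_lt_trans _ _ (\int[mu]_(x in `]0%R, 1%R[) (x `^ (z - 1))%:E)%E).
    apply: ge0_le_integral => //=.
    - by move=> x _; rewrite lee_fin f0.
    - exact: mf.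
    - apply: measurable_funTS; apply/measurable_EFinP; exact: measurable_powR.
    - move=> x; rewrite in_itv /= => /andP[x0 _]; rewrite lee_fin.
      by rewrite ler_piMr ?powR_ge0 // expR_le1; lra.
  by rewrite integral_powR_oo ?ltry //; lra.
apply: (@le_lt_trans _ _ (\int[mu]_(x in `[1%R, +oo[) (exponential_pdf 1 x)%:E)%E).
  apply: ge0_le_integral => //=.
  - by move=> x _; rewrite lee_fin f0.
  - exact: mf.
  - apply: measurable_funTS; apply/measurable_EFinP.
    exact: measurable_exponential_pdf.
  - move=> x; rewrite in_itv /= andbT => x1; rewrite lee_fin.
    rewrite exponential_pdfE; last by lra.
    rewrite mul1r mulN1r ler_piMl ?expR_ge0 //.
    rewrite -[z - 1]opprB powRN invf_le1 ?powR_gt0 //; last by lra.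
    rewrite -[leLHS](_ : 1 `^ (1 - z) = 1); last by rewrite powR1.
    by rewrite ge0_ler_powR ?nnegrE //; lra.
apply: (@le_lt_trans _ _ (\int[mu]_x (exponential_pdf 1 x)%:E)%E).
  apply: ge0_subset_integral => //=.
    by apply/measurable_EFinP; exact: measurable_exponential_pdf.
  by move=> x _; rewrite lee_fin exponential_pdf_ge0.
by rewrite integral_exponential_pdf // ltry.
Qed.

End GammaPos.

(** * Averages over an interval *)

Section Averages.
Context {R : realType}.
Notation mu := (@lebesgue_measure R).

Lemma average_bounds (f : R -> R) (a b c d : R) : a < b -> continuous f ->
  (forall x, a <= x <= b -> c <= f x <= d) ->
  c <= (b - a)^-1 * \int[mu]_(x in `[a, b]) f x <= d.
Proof.
move=> ab cf fcd; have ba : 0 < b - a by rewrite subr_gt0.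
have intg g : continuous g -> mu.-integrable `[a, b] (EFin \o g).
  move=> cg; apply: continuous_compact_integrable; first exact: segment_compact.
  exact: continuous_subspaceT.
have avg_cst k : \int[mu]_(x in `[a, b]) k = k * (b - a).
  rewrite Rintegral_cst; last exact: measurable_itv.
  have muab : lebesgue_measure `[a, b]%classic = (b - a)%:E.
    by rewrite lebesgue_measure_itv /= lte_fin ab.
  by congr (_ * _); rewrite -[RHS]/(fine (b - a)%:E) -muab.
rewrite -[X in X <= _](mulKf (lt0r_neq0 ba)) -[X in _ && (_ <= X)](mulKf (lt0r_neq0 ba)).
rewrite !ler_pM2l ?invr_gt0 // ![(b - a) * _]mulrC -!avg_cst.
apply/andP; split; apply: le_Rintegral => //.
- by apply: intg; exact: cst_continuous.
- exact: intg.
- by move=> x /=; rewrite in_itv /= => /fcd /andP[].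
- exact: intg.
- by apply: intg; exact: cst_continuous.
- by move=> x /=; rewrite in_itv /= => /fcd /andP[].
Qed.

(** On two consecutive intervals, the upper bound of the first is the lower
    bound of the second, which orders the two averages. *)
Lemma expR_average_bounds (s t a b : R) : 0 <= s -> a < b ->
  expR (- s * (t - a)) <=
    (b - a)^-1 * \int[mu]_(y in `[a, b]) expR (- s * (t - y)) <=
  expR (- s * (t - b)).
Proof.
move=> s0 ab; apply: average_bounds => //.
  move=> x; apply: (@continuous_comp _ _ _ (fun y : R => - s * (t - y)) expR).
    by apply: cvgMr; apply: cvgB; [exact: cvg_cst | exact: cvg_id].
  exact: continuous_expR.
by move=> x /andP[ax xb]; rewrite !ler_expR !mulNr !lerN2 !ler_wpM2l //; lra.
Qed.

End Averages.

(** * Graded mesh and temporal weights *)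

Section Grid.
Context {R : realType}.
Variables (T : R) (r M : nat).
Hypotheses (T_gt0 : 0 < T) (r_gt0 : (0 < r)%N) (M_gt0 : (0 < M)%N).
Local Notation t := (tgrid T r M).
Local Notation tau := (tstep T r M).

Let MR : 0 < M%:R :> R.
Proof. by rewrite ltr0n. Qed.

Lemma tgrid_mono : {homo t : m n / (m <= n)%N >-> m <= n}.
Proof.
move=> m n mn; rewrite /tgrid ler_pM2r //.
by rewrite lerXn2r ?nnegrE ?divr_ge0 // ler_pM2r ?invr_gt0 // ler_nat.
Qed.

Lemma tgrid_max : t M = T.
Proof. by rewrite /tgrid divff ?gt_eqF // expr1n mul1r. Qed.

Lemma tgrid_itv m : (m <= M)%N -> 0 <= t m <= T.
Proof.
move=> mM; rewrite -{3}tgrid_max tgrid_mono // andbT.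
by rewrite /tgrid mulr_ge0 ?exprn_ge0 ?divr_ge0 // ltW.
Qed.

(** The first step is the shortest; hence every [tau m] lies in the range where
    the exponential sum approximates the kernel. *)
Lemma first_step_le_tstep m : (0 < m)%N -> (1 / M%:R) ^+ r * T <= tau m.
Proof.
case: m => // m _; rewrite /tstep /tgrid /= -mulrBl ler_pM2r //.
rewrite lerBrDr !expr_div_n -mulrDl ler_pM2r ?invr_gt0 ?exprn_gt0 //.
by rewrite expr1n -!natrX nat1r ler_nat ltn_exp2r.
Qed.

Lemma tstep_gt0 m : (0 < m)%N -> 0 < tau m.
Proof.
move=> m0; apply: lt_le_trans (first_step_le_tstep m0).
by rewrite mulr_gt0 // exprn_gt0 // divr_gt0.
Qed.

(** Factoring [x^r - y^r] by [x - y = 1 / M] leaves [r] terms in [0, 1]. *)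
Lemma tstep_le m : (0 < m <= M)%N -> tau m <= r%:R * T / M%:R.
Proof.
case: m => // m /= mM; rewrite /tstep /tgrid /= -mulrBl subrXX.
rewrite (_ : m.+1%:R / M%:R - m%:R / M%:R = M%:R^-1); last first.
  by rewrite -mulrBl -natrB // subSnn mul1r.
rewrite [leRHS]mulrC mulrA ler_pM2r // ler_pM2l ?invr_gt0 //.
have frac_itv (k : nat) : (k <= M)%N -> 0 <= (k%:R / M%:R : R) <= 1.
  by move=> kM; rewrite divr_ge0 //= ler_pdivrMr // mul1r ler_nat.
have -> : r%:R = \sum_(i < r) (1 : R) by rewrite sumr_const card_ord.
apply: ler_sum => i _.
have /andP[p0 p1] := frac_itv m.+1 mM; have /andP[q0 q1] := frac_itv m (ltnW mM).
by rewrite mulr_ile1 ?exprn_ge0 ?exprn_ile1.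
Qed.

Variable gamma : R.
Hypothesis gamma_itv : 0 < gamma < 1.

Lemma acoef_diag m : (0 < m)%N ->
  acoef gamma T r M m m = (tau m) `^ (- gamma) / (1 - gamma).
Proof.
move=> m0; have tau0 := tstep_gt0 m0.
rewrite /acoef Rintegral_powRV_reflect //; last by rewrite -subr_gt0.
rewrite -/(tau m) powRB; last by rewrite (gt_eqF tau0) implybT.
by rewrite powRr1 ?(ltW tau0) // powRN mulrA mulrA mulVf ?gt_eqF // mul1r.
Qed.

Variables (Nexp : nat) (s w : 'I_Nexp -> R).
Hypotheses (Nexp_gt0 : (0 < Nexp)%N).
Hypotheses (s_gt0 : forall j, 0 < s j) (w_gt0 : forall j, 0 < w j).
Local Notation b := (bcoef gamma T r M s w).
Local Notation soe := (fun x : R => \sum_(j < Nexp) w j * expR (- s j * x)).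

Lemma bcoef_bounds m k : (0 < k < m)%N ->
  soe (t m - t k.-1) <= b m k <= soe (t m - t k).
Proof.
move=> /andP[k0 km]; rewrite /bcoef ltn_eqF //.
have tk : t k.-1 < t k by have := tstep_gt0 k0; rewrite subr_gt0.
by apply/andP; split; apply: ler_sum => j _; rewrite ler_pM2l //;
  have /andP[] := expR_average_bounds (t m) (ltW (s_gt0 j)) tk.
Qed.

(** For [m > 1] the weight is an average of a nonempty sum of exponentials with
    positive coefficients; for [m = 1] it is the exact singular one. *)
Lemma bcoef1_gt0 m : (0 < m)%N -> 0 < b m 1.
Proof.
move: m => [//|[_|m _]].
  rewrite /bcoef eqxx acoef_diag // divr_gt0 ?powR_gt0 ?tstep_gt0 //.
  by case/andP: gamma_itv => _; rewrite subr_gt0.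
have /andP[+ _] := @bcoef_bounds m.+2 1 isT; apply: lt_le_trans.
rewrite (bigD1 (Ordinal Nexp_gt0)) //= ltr_wpDr ?mulr_gt0 ?expR_gt0 //.
by apply: sumr_ge0 => j _; rewrite mulr_ge0 ?expR_ge0 // ltW.
Qed.

(** Both sides are compared through the exponential sum at [t m - t k].  For
    [k = m - 1] the right-hand side is the exact singular weight, whose excess
    [gamma / (1 - gamma) * tau_m^(-gamma)] over the kernel at [tau m] absorbs
    the approximation error. *)
Lemma bcoef_mono (eps : R) :
  soe_approx gamma eps ((1 / M%:R) ^+ r * T) T s w ->
  eps <= gamma / (1 - gamma) * (r%:R * T) `^ (- gamma) * M%:R `^ gamma ->
  forall m k, (0 < k < m)%N -> (m <= M)%N -> b m k <= b m k.+1.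
Proof.
move=> approx eps_le m k /[dup] km /andP[k0 km'] mM.
have /andP[_ bk] := bcoef_bounds km; apply: le_trans bk _.
have [km1|km1] := ltnP k.+1 m.
  by have /andP[] := @bcoef_bounds m k.+1 km1.
have mk : m = k.+1 by apply/eqP; rewrite eqn_leq km1.
have mP : (0 < m)%N by rewrite mk.
have tau0 := tstep_gt0 mP.
rewrite -mk /bcoef eqxx acoef_diag //.
have -> : t m - t k = tau m by rewrite /tstep mk.
have /approx : (1 / M%:R) ^+ r * T <= tau m <= T.
  rewrite first_step_le_tstep //=.
  have /andP[_ tmT] := tgrid_itv mM.
  have /andP[tm0 _] := tgrid_itv (leq_trans (leq_pred m) mM).
  by rewrite /tstep; lra.
rewrite distrC => /ler_distlDr soe_le; apply: le_trans soe_le _.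
case/andP: gamma_itv => g0 g1; have q0 : 0 < 1 - gamma by lra.
(* [1 / (1 - gamma) = 1 + gamma / (1 - gamma)] *)
have -> : tau m `^ (- gamma) / (1 - gamma) =
    tau m `^ (- gamma) + gamma / (1 - gamma) * tau m `^ (- gamma).
  by field; lra.
rewrite lerD2l; apply: le_trans eps_le _.
rewrite -mulrA ler_pM2l ?divr_gt0 //.
have rT : 0 < r%:R * T by rewrite mulr_gt0 // ltr0n.
rewrite !powRN ler_pdivrMl ?powR_gt0 // ler_pdivlMr ?powR_gt0 //.
rewrite -powRM ?(ltW tau0) //.
rewrite ge0_ler_powR ?nnegrE ?mulr_ge0 ?(ltW T_gt0) ?(ltW tau0) ?(ltW rT) ?(ltW g0) //.
by rewrite mulrC -ler_pdivlMr // tstep_le // mP.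
Qed.

End Grid.

(** * Unique solvability and stability *)

Lemma xgrid_itv (R : realType) (l : R) (N i : nat) : 0 < l -> (0 < i < N)%N ->
  - l < xgrid l N i < l.
Proof.
move=> l0 /andP[i0 iN]; rewrite /xgrid /hstep.
have N0 : (0 < N)%N by exact: leq_trans iN.
have NR : 0 < N%:R :> R by rewrite ltr0n.
rewrite mulrA ltrDl divr_gt0 ?mulr_gt0 ?ltr0n //= addrC ltrBlDr.
rewrite ltr_pdivrMr // (_ : l + l = 2 * l); last by lra.
by rewrite mulrC ltr_pM2l ?ltr_nat // mulr_gt0.
Qed.

Section FIDSasMemoryScheme.
Variables (R : realType) (gamma alpha mu T l : R) (r M N Nexp : nat).
Variables (s w : 'I_Nexp -> R) (kappa f : R -> R -> R) (phi : R -> R).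

Definition interior : pred 'I_N.+1 := fun i => (0 < i < N)%N.

Lemma FIDS_memory_scheme (u : 'M[R]_(M.+1, N.+1)) :
  FIDS gamma alpha mu T l r s w kappa f phi u <->
  memory_scheme interior (fun i j => fraclap_coef alpha mu l N i j)
    (fun m i => kappa (xgrid l N i) (tgrid T r M m)) (bcoef gamma T r M s w)
    (Gamma (1 - gamma)) (fun m i => f (xgrid l N i) (tgrid T r M m))
    (fun i => phi (xgrid l N i)) u.
Proof.
split=> -[stepu bdu iniu]; split.
- by move=> m m0 i Pi; exact: stepu.
- move=> m i nPi; have [u0 uN] := bdu m; have := ltn_ord i.
  rewrite ltnS leq_eqVlt => /predU1P[iN|iN].
    by rewrite (_ : i = ord_max) //; exact: val_inj.
  move: nPi; rewrite /interior iN andbT -leqNgt leqn0 => /eqP i0.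
  by rewrite (_ : i = ord0) //; exact: val_inj.
- exact: iniu.
- by move=> m i m0 Pi; exact: stepu.
- by split; apply: bdu; rewrite /interior /= ?ltnn ?andbF.
- exact: iniu.
Qed.

End FIDSasMemoryScheme.

Theorem theorem2p2 (R : realType) (gamma T : R) (r : nat)
    (hgamma : 0 < gamma < 1) (hT : 0 < T) (hr : (0 < r)%N) :
  exists c1 : R, 0 < c1 /\
    forall (alpha mu l : R) (kappa f : R -> R -> R) (phi : R -> R)
      (M N Nexp : nat) (eps : R) (s w : 'I_Nexp -> R),
      0 < alpha < 2 -> alpha < mu <= 2 -> 0 < l ->
      (forall x t : R, - l < x < l -> 0 <= t <= T -> 0 < kappa x t) ->
      (0 < M)%N -> (0 < N)%N -> (0 < Nexp)%N ->
      0 < eps ->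
      (forall j : 'I_Nexp, 0 < s j) -> (forall j : 'I_Nexp, 0 < w j) ->
      soe_approx gamma eps ((1 / M%:R) ^+ r * T) T s w ->
      eps <= c1 * M%:R `^ gamma ->
      (exists! u : 'M[R]_(M.+1, N.+1),
          FIDS gamma alpha mu T l r s w kappa f phi u) /\
      (forall u : 'M[R]_(M.+1, N.+1),
          FIDS gamma alpha mu T l r s w kappa f phi u ->
          forall k : 'I_M.+1, (0 < k)%N ->
            supnorm (u k) <= supnorm (u ord0) + Gamma (1 - gamma) *
              \big[Num.max/0]_(1 <= p < k.+1)
                (supnorm (fun i : 'I_N.+1 => f (xgrid l N i) (tgrid T r M p))
                 / bcoef gamma T r M s w p 1)).
Proof.
have /andP[g0 g1] := hgamma.
exists (gamma / (1 - gamma) * (r%:R * T) `^ (- gamma)); split.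
  by rewrite mulr_gt0 ?divr_gt0 ?subr_gt0 ?powR_gt0 ?mulr_gt0 ?ltr0n.
move=> alpha mu l kappa f phi M N Nexp eps s w /andP[a0 _] /andP[amu _] l0 kappa0
  M0 N0 Nexp0 _ s0 w0 approx eps_le.
have Gamma0 : 0 < Gamma (1 - gamma) by apply: Gamma_gt0; apply/andP; split; lra.
have kap0 m (i : 'I_N.+1) : (0 < m <= M)%N -> interior i ->
    0 <= kappa (xgrid l N i) (tgrid T r M m).
  by move=> /andP[_ mM] Pi; rewrite ltW // kappa0 ?xgrid_itv ?tgrid_itv.
have dom (i : 'I_N.+1) : interior i -> \sum_(j | interior j && (j != i))
    `|fraclap_coef alpha mu l N i j| <= fraclap_coef alpha mu l N i i.
  exact: fraclap_dominant.
have b1 m : (0 < m <= M)%N -> 0 < bcoef gamma T r M s w m 1.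
  by move=> /andP[m0 _]; exact: bcoef1_gt0.
have bmono := bcoef_mono hT hr M0 hgamma s0 w0 approx eps_le.
split.
  have [u uP] := memory_scheme_exists Gamma0 kap0 dom b1 bmono
    (fun m i => f (xgrid l N i) (tgrid T r M m)) (fun i => phi (xgrid l N i)).
  exists u; split; first exact/FIDS_memory_scheme.
  move=> u' /FIDS_memory_scheme u'P.
  exact: (memory_scheme_uniq Gamma0 kap0 dom b1 bmono uP u'P).
move=> u /FIDS_memory_scheme [stepu _ _] k _.
exact: (memory_stable Gamma0 kap0 dom b1 bmono stepu).
Qed.
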